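(* Let $T=(I,E)$ be a finite tree with conductance matrix $C$ and let $S^0\subseteq I$ be a set of leaves of $T$. Consider the message passing algorithm on $(T,C,S^0)$ described in the context. Then: (1) the algorithm converges after at most $\operatorname{diam}(T)$ steps, i.e. after at most $\operatorname{diam}(T)$ steps every node $i\in I\setminus S^0$ has received the messages of all its neighbors, and the value it then computes is its Harmonic Influence Centrality $H(i)$; (2) the number of messages to be sent by node $i$ is $d_i$; (3) the number of messages to be sent in the whole network is not larger than $2|I|$; (4) the number of arithmetic operations to be performed by each node $i$ is $O(d_i^2)$; (5) the number of arithmetic operations for the whole network is $O\big(\sum_{i\in I\setminus S^0}d_i^2\big)$.
   Context: Conductance matrix: a symmetric nonnegative matrix $C\in\mathbb{R}^{I\times I}$ with $C_{ij}>0$ iff $\{i,j\}\in E$; the resistance of edge $\{i,j\}$ is $R_{ij}=1/C_{ij}$. $N_i$ is the neighbor set of $i$ and $d_i=|N_i|$. $\operatorname{diam}(T)$ is the maximum graph distance between two nodes. For $\ell\in I\setminus S^0$, $W^{(\ell)}:I\to\mathbb{R}$ is the unique function with $W^{(\ell)}(s)=0$ for $s\in S^0$, $W^{(\ell)}(\ell)=1$, and $\sum_{j\in N_i}C_{ij}\,(W^{(\ell)}(i)-W^{(\ell)}(j))=0$ for every $i\in I\setminus(S^0\cup\{\ell\})$. The Harmonic Influence Centrality is here $H(\ell)=\sum_{i\in I}W^{(\ell)}(i)$. Message passing algorithm on a tree: each node $i$ sends to each neighbor $j$ exactly one message, consisting of the pair $(H^{i\to j},W^{i\to j})$. A leaf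 $i$ with neighbor $j$ can send its message at the first step, with $H^{i\to j}=W^{i\to j}=1$ if $i\notin S^0$ and $H^{i\to j}=W^{i\to j}=0$ if $i\in S^0$. A non-leaf node $i$ sends its message to $j$ at the first step after it has received the messages of all neighbors $k\in N_i\setminus\{j\}$, with $$H^{i\to j}=\sum_{k\in N_i\setminus\{j\}}W^{k\to i}H^{k\to i}+1,$$ $$W^{i\to j}=\Big(1+R_{ij}\sum_{k\in N_i\setminus\{j\}}\frac{1-W^{k\to i}}{R_{ik}}\Big)^{-1}.$$ All nodes operate synchronously and in parallel; a message sent in a step is received by the end of that step. When a node $i\in I\setminus S^0$ has received the messages of all its neighbors, it outputs $\sum_{k\in N_i}W^{k\to i}H^{k\to i}+1$. Each message and output is evaluated directly from the formulas above; the constant initial messages of leaves require no arithmetic operations. *)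

(* Defs.v *)
From HB Require Import structures.
From mathcomp Require Import all_boot all_order all_algebra.
Set Implicit Arguments.
Unset Strict Implicit.
Unset Printing Implicit Defensive.
Import Order.TTheory GRing.Theory Num.Theory.

(* Graphs are adjacency relations [e : rel I] on a finite type of nodes. *)

Definition nbrs (I : finType) (e : rel I) (i : I) : {set I} := [set j | e i j].

Definition deg (I : finType) (e : rel I) (i : I) : nat := #|nbrs e i|.

Definition leaf (I : finType) (e : rel I) (i : I) : bool := deg e i == 1.

(* A cyclic walk [:: x; y] only goes back and forth along an edge, hence the
   bound 2. *)
Definition is_tree (I : finType) (e : rel I) : Prop :=
  [/\ symmetric e, irreflexive e, 0 < #|I|,
      forall x y : I, connect e x y
    & forall c : seq I, uniq c -> cycle e c -> size c <= 2].

(* Length of a shortest path; the junk value #|I| for disconnected nodes is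
   never reached in a connected graph. *)
Definition dist (I : finType) (e : rel I) (x y : I) : nat :=
  find (fun n => [exists p : n.-tuple I, path e x p && (last x p == y)])
       (iota 0 #|I|).

Definition diam (I : finType) (e : rel I) : nat :=
  \max_(x : I) \max_(y : I) dist e x y.

(* Arithmetic expressions over known values.  Evaluating one costs one
   operation per internal node, so that the values computed by the algorithm
   and the number of operations they cost are read off the same object. *)
Inductive aexpr (R : Type) : Type :=
  | EVal of R
  | EAdd of aexpr R & aexpr R
  | ESub of aexpr R & aexpr R
  | EMul of aexpr R & aexpr R
  | EDiv of aexpr R & aexpr R
  | EInv of aexpr R.

Fixpoint eval (R : unitRingType) (a : aexpr R) : R :=
  match a with
  | EVal x => x
  | EAdd a b => eval a + eval b
  | ESub a b => eval a - eval b
  | EMul a b => eval a * eval b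
  | EDiv a b => eval a / eval b
  | EInv a => (eval a)^-1
  end%R.

Fixpoint ops (R : Type) (a : aexpr R) : nat :=
  match a with
  | EVal _ => 0
  | EAdd a b | ESub a b | EMul a b | EDiv a b => (ops a + ops b).+1
  | EInv a => (ops a).+1
  end.

(* A sum of n > 0 terms takes n - 1 additions, an empty sum none. *)
Definition esum (R : pzRingType) (s : seq (aexpr R)) : aexpr R :=
  if s is a :: s' then foldl (@EAdd R) a s' else EVal 0%R.

Section Network.
Variables (R : realFieldType) (I : finType) (e : rel I).
Variables (C : I -> I -> R) (S0 : {set I}).

Definition is_conductance : Prop :=
  [/\ forall i j, C i j = C j i,
      forall i j, (0 <= C i j)%R
    & forall i j, (0 < C i j)%R <-> e i j].

Definition resistance (i j : I) : R := (1 / C i j)%R.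

Definition is_potential (l : I) (W : {ffun I -> R}) : Prop :=
  [/\ forall s, s \in S0 -> W s = 0%R,
      W l = 1%R
    & forall i, i \notin S0 :|: [set l] ->
        (\sum_(j in nbrs e i) C i j * (W i - W j) = 0)%R].

(* [h] is the Harmonic Influence Centrality of [l]; that the potential exists
   and is unique is part of the assertion. *)
Definition is_HIC (l : I) (h : R) : Prop :=
  exists W : {ffun I -> R},
    unique (is_potential l) W /\ h = (\sum_(i : I) W i)%R.

(* [st i j] is the message (H, W) that [i] has sent to [j], if any.  A message
   sent in a step is received by the end of it, so [st i j] is also what [j]
   has received from [i]. *)
Definition state : Type := I -> I -> option (R * R).

(* The default 0 is never used: messages and outputs are only evaluated once
   all the incoming messages they depend on are there. *)
Definition msgH (st : state) (i j : I) : R :=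
  if st i j is Some m then m.1 else 0%R.

Definition msgW (st : state) (i j : I) : R :=
  if st i j is Some m then m.2 else 0%R.

(* \sum_(k in A) W^{k -> i} H^{k -> i} + 1, as a sum of #|A| + 1 terms. *)
Definition exprH (st : state) (i : I) (A : {set I}) : aexpr R :=
  esum (rcons [seq EMul (EVal (msgW st k i)) (EVal (msgH st k i)) | k <- enum A]
              (EVal 1%R)).

Definition exprW (st : state) (i j : I) : aexpr R :=
  EInv (EAdd (EVal 1%R)
    (EMul (EVal (resistance i j))
      (esum [seq EDiv (ESub (EVal 1%R) (EVal (msgW st k i)))
                      (EVal (resistance i k))
            | k <- enum (nbrs e i :\ j)]))).

Definition message (st : state) (i j : I) : aexpr R * aexpr R :=
  if leaf e i then
    if i \in S0 then (EVal 0%R, EVal 0%R) else (EVal 1%R, EVal 1%R)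
  else (exprH st i (nbrs e i :\ j), exprW st i j).

(* In state [st], node [i] sends its message to [j] in the next step. *)
Definition sends (st : state) (i j : I) : bool :=
  [&& e i j, ~~ isSome (st i j)
    & leaf e i || [forall k in nbrs e i :\ j, isSome (st k i)]].

Definition step (st : state) : state := fun i j =>
  if sends st i j then
    Some (eval (message st i j).1, eval (message st i j).2)
  else st i j.

Definition run (t : nat) : state := iter t step (fun _ _ => None).

Definition received_all (st : state) (i : I) : bool :=
  [forall k in nbrs e i, isSome (st k i)].

(* What [i] outputs once [received_all st i]. *)
Definition output (st : state) (i : I) : aexpr R := exprH st i (nbrs e i).

(* Messages sent, resp. operations performed, by [i] in the first [t] steps. *)
Definition nb_sent (t : nat) (i : I) : nat :=
  \sum_(s < t) #|[set j | sends (run s) i j]|.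

Definition nb_ops (t : nat) (i : I) : nat :=
  \sum_(s < t) \sum_(j | sends (run s) i j)
     (ops (message (run s) i j).1 + ops (message (run s) i j).2)
  + (if (i \notin S0) && received_all (run t) i
     then ops (output (run t) i) else 0).

End Network.

(* Main.v *)
Require Import Defs.
From HB Require Import structures.
From mathcomp Require Import all_boot all_order all_algebra.
Set Implicit Arguments.
Unset Strict Implicit.
Unset Printing Implicit Defensive.
Import Order.TTheory GRing.Theory Num.Theory.

(** Cut the edge between two adjacent nodes [i] and [j] of a tree and keep the
    part of [i]: this is [branch e i j], and the message from [i] to [j] is a
    summary of it. In a tree the branches at a node are disjoint
    ([branch_inj]), they cover everything but the node ([tree_decomp]), and
    the branch of [i] seen from [j] is [i] together with the branches of its
    other neighbours seen from [i] ([branch_decomp]). The last fact has the same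
    shape as the recursion of the algorithm.

    Correctness. Let [F] vanish on [S0] and be harmonic elsewhere on
    [branch e i j]. By induction on the messages ([run_correct]),
    [F i = W^{i -> j} * F j], the sum of [F] over the branch is
    [H^{i -> j} * F i], and [F] is zero on the branch if [F j = 0]. The first
    equation is the harmonicity at [i] solved for [F i], after the values at the
    other neighbours [k] are replaced by [W^{k -> i} * F i]. Applied to all the
    branches at a node [l] that has received its messages, this gives three
    things: the sum of a potential of [l] is the output of [l]; the difference
    of two potentials is zero; and the linear operator whose equation defines
    the potential is injective, hence onto by finite dimension, so that a
    potential exists.

    Time. If the message from [i] to [j] is not there after [t] steps, then one
    that it waits for was not there after [t - 1], and so on; this traces a
    simple path with [t + 1] edges ([unsent_path]). In a tree a simple path is
    the only one between its ends, hence a shortest one, so that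
    [t < diam e].

    Counting. A message is sent once per directed edge. Fix a root: every edge
    points to the root in one of its two directions, and every node has at most
    one neighbour in the direction of the root, so there are at most [2 * #|I|]
    directed edges ([sum_deg_le]). One message costs at most [5 * deg e i]
    operations and the output [2 * deg e i]; nodes of [S0] are leaves and
    compute nothing. *)

(** * Branches of a tree *)

Section Tree.
Variables (I : finType) (e : rel I).

Definition avoiding (r : I) : rel I := fun x y => [&& e x y, x != r & y != r].

(** For adjacent [i] and [j] in a tree, this is the component of [i] after the
    edge between [i] and [j] is cut. *)
Definition branch (i j : I) : {set I} := [set v | connect (avoiding j) i v].

Hypothesis tree_e : is_tree e.

Lemma tree_sym i j : e i j = e j i.
Proof. by case: tree_e => sym_e *; apply: sym_e. Qed.

Lemma edge_neq i j : e i j -> i != j.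
Proof.
by have [_ irr_e _ _ _] := tree_e; apply: contraTneq => ->; rewrite irr_e.
Qed.

Lemma path_avoiding r x p :
  path e x p -> r \notin x :: p -> path (avoiding r) x p.
Proof.
elim: p x => //= y p IHp x /andP[e_xy path_p].
rewrite !inE !negb_or => /and3P[r_x r_y r_p].
rewrite /avoiding e_xy eq_sym r_x eq_sym r_y /=.
by apply: IHp => //; rewrite inE negb_or r_y.
Qed.

Lemma avoiding_path r x p : path (avoiding r) x p -> path e x p.
Proof. by apply: sub_path => u v /and3P[]. Qed.

Lemma avoiding_notin r x p :
  x != r -> path (avoiding r) x p -> r \notin x :: p.
Proof.
elim: p x => [|y p IHp] x x_r /=; first by rewrite inE eq_sym.
case/andP=> /and3P[_ _ y_r] /(IHp _ y_r) r_p.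
by rewrite inE negb_or eq_sym x_r.
Qed.

Lemma avoiding_connect_sym r : connect_sym (avoiding r).
Proof.
apply: sym_connect_sym => x y.
by rewrite /avoiding tree_sym; congr (_ && _); rewrite andbC.
Qed.

Lemma branch_self i j : i \in branch i j.
Proof. by rewrite inE connect0. Qed.

Lemma notin_branch i k : e i k -> i \notin branch k i.
Proof.
move=> e_ik; rewrite inE; apply/connectP=> -[p path_p def_i].
have /(avoiding_notin)/(_ path_p) : k != i by rewrite eq_sym edge_neq.
by rewrite {1}def_i mem_last.
Qed.

(** A node in two branches would join two neighbours of [i] by a path that
    avoids [i]; together with [i] it closes a cycle of length at least 3. *)
Lemma branch_inj i k k' v :
  e i k -> e i k' -> v \in branch k i -> v \in branch k' i -> k = k'.
Proof.
move=> e_ik e_ik'; rewrite !inE => k_v; rewrite avoiding_connect_sym => v_k'.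
have /connectP[q path_q] := connect_trans k_v v_k'.
case/shortenP: path_q => p path_p uniq_p _ def_k'.
have i_p : i \notin k :: p by rewrite avoiding_notin // eq_sym edge_neq.
have [_ _ _ _ acyclic] := tree_e.
have := acyclic (i :: k :: p); rewrite cons_uniq i_p uniq_p.
rewrite /= rcons_path e_ik (avoiding_path path_p) -def_k' tree_sym e_ik' /=.
by case: p def_k' {path_p uniq_p i_p} => //= y p _ /(_ isT isT).
Qed.

(** A path that leaves [i] through [k] without returning to [i] cannot reach
    another neighbour [j] of [i], since that would put [j] in the branch of
    [k]. *)
Lemma path_avoiding_nbr i j k p :
  e i j -> e i k -> k != j -> path (avoiding i) k p -> path (avoiding j) k p.
Proof.
move=> e_ij e_ik k_j path_p.
apply: path_avoiding; first exact: avoiding_path path_p.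
apply/negP=> j_p; case/negP: k_j; apply/eqP.
apply: (branch_inj e_ik e_ij _ (branch_self _ _)); rewrite inE.
by case/splitPl: j_p path_p => p1 p2 <-; rewrite cat_path => /andP[p1P _];
  apply/connectP; exists p1.
Qed.

Lemma branch_sub i j k :
  e i j -> e i k -> k != j -> branch k i \subset branch i j.
Proof.
move=> e_ij e_ik k_j; apply/subsetP=> v; rewrite !inE => /connectP[p path_p ->].
have path_jp := path_avoiding_nbr e_ij e_ik k_j path_p.
apply/connectP; exists (k :: p) => //=; rewrite path_jp andbT /avoiding e_ik.
by rewrite k_j edge_neq.
Qed.

Lemma simple_path_branch i k p :
  path e i (k :: p) -> uniq (i :: k :: p) -> last k p \in branch k i.
Proof.
move=> /= /andP[_ path_p] /andP[i_p _]; rewrite inE.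
by apply/connectP; exists p => //; apply: path_avoiding.
Qed.

Lemma branch_cover i v : v != i -> exists2 k, e i k & v \in branch k i.
Proof.
move=> v_i; have [_ _ _ conn_e _] := tree_e.
have /connectP[q path_q] := conn_e i v.
case/shortenP: path_q => -[_ _ _ /= def_v|k p path_p uniq_p _ def_v].
  by rewrite def_v eqxx in v_i.
exists k; first by case/andP: path_p.
by rewrite def_v (simple_path_branch path_p).
Qed.

Lemma branch_decomp i j : e i j ->
  branch i j :\ i = \bigcup_(k in nbrs e i :\ j) branch k i.
Proof.
move=> e_ij; apply/setP=> v; apply/setD1P/bigcupP=> [[v_i]|[k]].
  rewrite inE => /connectP[q path_q].
  case/shortenP: path_q => -[_ _ _ /= def_v|k p path_p uniq_p _ def_v].
    by rewrite def_v eqxx in v_i.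
  exists k; last first.
    by rewrite def_v (simple_path_branch (avoiding_path path_p)).
  by case/andP: path_p => /and3P[e_ik _ k_j] _; rewrite !inE k_j.
case/setD1P=> k_j; rewrite [k \in _]inE => e_ik v_k; split.
  by apply: contraTneq v_k => ->; rewrite notin_branch.
exact: subsetP (branch_sub e_ij e_ik k_j) v v_k.
Qed.

Lemma tree_decomp i : [set~ i] = \bigcup_(k in nbrs e i) branch k i.
Proof.
apply/setP=> v; rewrite in_setC1.
apply/idP/bigcupP=> [/branch_cover[k e_ik v_k]|[k]].
  by exists k; rewrite // inE.
rewrite inE => e_ik v_k.
by apply: contraTneq v_k => ->; rewrite notin_branch.
Qed.

Lemma sum_branches (R : nmodType) (F : I -> R) i (A : {set I}) :
  A \subset nbrs e i ->
  (\sum_(v in \bigcup_(k in A) branch k i) F v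
     = \sum_(k in A) \sum_(v in branch k i) F v)%R.
Proof.
move=> /subsetP A_nbrs.
rewrite [\bigcup_(k in A) _]big_mkcond partition_disjoint_bigcup /= => [|k k' k_k'].
  rewrite [RHS]big_mkcond; apply: eq_bigr => k _.
  by case: ifP => // _; rewrite big_set0.
case: ifP => [k_A|_]; last by rewrite disjoints_subset sub0set.
case: ifP => [k'_A|_]; last by rewrite disjoint_sym disjoints_subset sub0set.
apply/pred0P=> v /=; apply: contraNF k_k' => /andP[v_k v_k']; apply/eqP.
have := A_nbrs _ k_A; have := A_nbrs _ k'_A; rewrite !inE => e_ik' e_ik.
exact: (branch_inj e_ik e_ik' v_k v_k').
Qed.

Lemma sum_branch (R : nmodType) (F : I -> R) i j : e i j ->
  (\sum_(v in branch i j) F v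
     = F i + \sum_(k in nbrs e i :\ j) \sum_(v in branch k i) F v)%R.
Proof.
move=> e_ij; rewrite (big_setD1 i) ?branch_self //= branch_decomp //.
by rewrite sum_branches // subsetDl.
Qed.

Lemma sum_tree (R : nmodType) (F : I -> R) i :
  (\sum_v F v = F i + \sum_(k in nbrs e i) \sum_(v in branch k i) F v)%R.
Proof.
rewrite (bigD1 i) //= -sum_branches // -tree_decomp; congr (_ + _)%R.
by apply: eq_bigl => v; rewrite !inE.
Qed.

(** * Simple paths and the diameter *)

(** The first steps agree because the common end lies in one branch only. *)
Lemma simple_path_unique x p q :
  path e x p -> path e x q -> uniq (x :: p) -> uniq (x :: q) ->
  last x p = last x q -> p = q.
Proof.
elim: p x q => [|k p IHp] x [|k' q] //=.
- by move=> _ _ _ /andP[/negP x_q _] def_x; case: x_q; rewrite def_x mem_last.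
- by move=> _ _ /andP[/negP x_p _] _ def_x; case: x_p; rewrite -def_x mem_last.
move=> path_p path_q uniq_p uniq_q eq_last.
have v_k := simple_path_branch path_p uniq_p.
have := simple_path_branch path_q uniq_q; rewrite -eq_last => v_k'.
case/andP: path_p path_q => e_xk path_p /andP[e_xk' path_q].
have def_k' := branch_inj e_xk e_xk' v_k v_k'; subst k'.
case/andP: uniq_p uniq_q => _ uniq_p /andP[_ uniq_q].
by congr cons; apply: IHp eq_last.
Qed.

Lemma simple_path_dist x p :
  path e x p -> uniq (x :: p) -> size p <= dist e x (last x p).
Proof.
move=> path_p uniq_p; rewrite /dist.
(* If no length is found, [dist] has its default value [#|I|], which bounds the
   length of every simple path. *)
set joined := fun n => _; set s := iota 0 #|I|.
have [found|] := boolP (has joined s); last first.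
  move/hasNfind=> ->; rewrite size_iota ltnW //.
  by have := max_card (mem (x :: p)); rewrite (card_uniqP uniq_p).
have lt_n : find joined s < #|I| by rewrite -[ltnRHS](size_iota 0) -has_find.
have := nth_find 0 found; rewrite nth_iota // add0n.
set n := find _ _; case/existsP=> q /andP[path_q /eqP last_q].
rewrite -(size_tuple q).
case/shortenP: path_q last_q => q' path_q' uniq_q' sub_q' eq_q'.
rewrite -(simple_path_unique path_q' path_p uniq_q' uniq_p eq_q').
by apply: uniq_leq_size sub_q'; case/andP: uniq_q'.
Qed.

Lemma simple_path_diam x p :
  path e x p -> uniq (x :: p) -> size p <= diam e.
Proof.
move=> path_p uniq_p; apply: leq_trans (simple_path_dist path_p uniq_p) _.
exact: leq_trans (leq_bigmax (last x p)) (leq_bigmax x).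
Qed.

(** * The number of edges *)

(** Every edge is directed towards a root [r] in one way and away from it in
    the other; each node has at most one neighbour in the direction of [r]. *)
Lemma sum_deg_le : \sum_i deg e i <= 2 * #|I|.
Proof.
have /card_gt0P[r _] : 0 < #|I| by case: tree_e.
pose up i := [set j | e i j & r \in branch j i].
pose down i := [set j | e i j & r \in branch i j].
have up_le1 i : #|up i| <= 1.
  apply/card_le1P=> j; rewrite inE => /andP[e_ij r_j] k.
  rewrite [in LHS]inE [in RHS]inE; apply/andP/eqP=> [[e_ik r_k]|-> //].
  exact: branch_inj r_k r_j.
have deg_le i : deg e i <= #|up i| + #|down i|.
  apply: leq_trans (leq_card_setU _ _); apply/subset_leq_card/subsetP=> j.
  rewrite inE => e_ij.
  rewrite in_setU [j \in up i]inE [j \in down i]inE e_ij /=.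
  have [->|r_i] := eqVneq r i; first by rewrite branch_self orbT.
  have [k e_ik r_k] := branch_cover r_i.
  have [<-|k_j] := eqVneq k j; first by rewrite r_k.
  by rewrite [_ \in branch i j](subsetP (branch_sub e_ij e_ik k_j)) ?orbT.
have sum_up : \sum_i #|up i| <= #|I|.
  by rewrite -sum1_card; apply: leq_sum => i _; apply: up_le1.
have sum_down : \sum_i #|down i| = \sum_i #|up i|.
  under eq_bigr do rewrite -sum1dep_card big_mkcond.
  rewrite exchange_big; apply: eq_bigr => j _.
  by rewrite -sum1dep_card [RHS]big_mkcond; under eq_bigr do rewrite tree_sym.
apply: (@leq_trans (\sum_i (#|up i| + #|down i|))).
  by apply: leq_sum => i _; apply: deg_le.
by rewrite big_split /= sum_down addnn mul2n leq_double.
Qed.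

End Tree.

(** * Values and costs of the messages *)

Section Expressions.
Local Open Scope ring_scope.

Lemma eval_esum (R : unitRingType) (s : seq (aexpr R)) :
  eval (esum s) = \sum_(a <- s) eval a.
Proof.
case: s => [|a s] /=; first by rewrite big_nil.
rewrite big_cons; elim: s a => [|b s IHs] a /=; first by rewrite big_nil addr0.
by rewrite IHs big_cons addrA.
Qed.

Lemma ops_esum (R : pzRingType) (s : seq (aexpr R)) :
  ops (esum s) = (\sum_(a <- s) ops a + (size s).-1)%N.
Proof.
case: s => [|a s] /=; first by rewrite big_nil.
rewrite big_cons; elim: s a => [|b s IHs] a /=; first by rewrite big_nil !addn0.
by rewrite IHs big_cons /= addSn addnS -addnA.
Qed.

Variables (R : realFieldType) (I : finType) (e : rel I) (C : I -> I -> R).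
Variables (S0 : {set I}) (st : state R I).

Lemma eval_exprH i A :
  eval (exprH st i A) = \sum_(k in A) msgW st k i * msgH st k i + 1.
Proof.
rewrite eval_esum big_rcons /=; congr (_ + _).
by rewrite big_map big_enum.
Qed.

Lemma eval_exprW i j :
  eval (exprW e C st i j)
  = (1 + resistance C i j
         * \sum_(k in nbrs e i :\ j) (1 - msgW st k i) / resistance C i k)^-1.
Proof. by rewrite /= eval_esum big_map big_enum. Qed.

Lemma ops_exprH i A : ops (exprH st i A) = (2 * #|A|)%N.
Proof.
rewrite ops_esum size_rcons size_map -cardE /= big_rcons /= addn0.
by rewrite big_map sum1_size -cardE mul2n addnn.
Qed.

Lemma ops_exprW i j : (ops (exprW e C st i j) <= 3 * #|nbrs e i :\ j| + 3)%N.
Proof.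
rewrite /= ops_esum size_map -cardE big_map /=.
rewrite big_const_seq count_predT -cardE iter_addn_0 !add0n.
by rewrite addn3 !ltnS (mulnDl 2 1) mul1n leq_add2l leq_pred.
Qed.

Lemma leaf_nbrs i j : leaf e i -> e i j -> nbrs e i :\ j = set0.
Proof.
move=> /cards1P[k def_k] e_ij.
have : j \in nbrs e i by rewrite inE.
by rewrite def_k inE => /eqP->; rewrite setDv.
Qed.

(** The constant message of a leaf outside [S0] is the general formula
    with no incoming message. *)
Lemma eval_message i j : e i j -> i \notin S0 ->
  eval (message e C S0 st i j).1 = eval (exprH st i (nbrs e i :\ j)) /\
  eval (message e C S0 st i j).2 = eval (exprW e C st i j).
Proof.
move=> e_ij /negPf iS0; rewrite /message; case: ifP => // leaf_i.
rewrite iS0 eval_exprH eval_exprW leaf_nbrs // !big_set0 /=.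
by rewrite mulr0 addr0 add0r invr1.
Qed.

Lemma ops_message i j : e i j ->
  (ops (message e C S0 st i j).1 + ops (message e C S0 st i j).2
     <= 5 * deg e i)%N.
Proof.
move=> e_ij; rewrite /message; case: ifP => [_|_]; first by case: ifP.
have deg_i : deg e i = #|nbrs e i :\ j|.+1.
  by rewrite /deg (cardsD1 j) inE e_ij.
(* With [d = deg e i] the two parts cost at most [2 * (d - 1)] and
   [3 * (d - 1) + 3], that is [5 * d - 2] together. *)
apply: leq_trans (leq_add (eq_leq (ops_exprH _ _)) (ops_exprW _ _)) _.
by rewrite deg_i mulnS addnA -mulnDl addnC leq_add2r.
Qed.

End Expressions.

(** * Messages sent and time of convergence *)

Section Run.
Variables (R : realFieldType) (I : finType) (e : rel I) (C : I -> I -> R).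
Variables (S0 : {set I}).
Local Notation run := (run e C S0).

(** A leaf waits for nobody, hence obeys the same rule as the other nodes. *)
Lemma sendsE (st : state R I) i j :
  sends e st i j
  = [&& e i j, ~~ isSome (st i j)
      & [forall k in nbrs e i :\ j, isSome (st k i)]].
Proof.
rewrite /sends; case e_ij: (e i j) => //=; congr (_ && _).
case leaf_i: (leaf e i) => //=; rewrite leaf_nbrs //.
by apply/esym/forall_inP=> k; rewrite inE.
Qed.

Lemma runS_isSome t i j :
  isSome (run t.+1 i j) = sends e (run t) i j || isSome (run t i j).
Proof. by rewrite /run iterS {1}/step; case: ifP. Qed.

Lemma run_edge t i j : isSome (run t i j) -> e i j.
Proof.
by elim: t => // t IHt; rewrite runS_isSome => /orP[/and3P[]|/IHt].
Qed.

(** Messages are never overwritten, so the numbers sent at each step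
    telescope. *)
Lemma nb_sentE t i : nb_sent e C S0 t i = #|[set j | isSome (run t i j)]|.
Proof.
rewrite /nb_sent; elim: t => [|t IHt]; first by rewrite big_ord0 cards0.
rewrite big_ord_recr /= IHt addnC.
rewrite -cardsUI [_ :&: _](_ : _ = set0) ?cards0 ?addn0.
  by apply: eq_card => j; rewrite !inE -runS_isSome.
apply/setP=> j; rewrite !inE /sends.
by case: (isSome _) => //=; rewrite ?andbF.
Qed.

Lemma nb_sent_le t i : nb_sent e C S0 t i <= deg e i.
Proof.
rewrite nb_sentE; apply/subset_leq_card/subsetP=> j.
by rewrite !inE; apply: run_edge.
Qed.

(** There are at most [deg e i] messages at a cost of at most [5 * deg e i]
    each, and an output at a cost of at most [2 * deg e i ^ 2]. *)
Lemma nb_ops_le t i : nb_ops e C S0 t i <= 7 * deg e i ^ 2.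
Proof.
rewrite /nb_ops.
have sum_le : \sum_(s < t) \sum_(j | sends e (run s) i j)
     (ops (message e C S0 (run s) i j).1 + ops (message e C S0 (run s) i j).2)
   <= nb_sent e C S0 t i * (5 * deg e i).
  rewrite /nb_sent big_distrl /=; apply: leq_sum => s _.
  rewrite -sum1dep_card big_distrl /=; apply: leq_sum => j /and3P[e_ij _ _].
  by rewrite mul1n ops_message.
have out_le : (if (i \notin S0) && received_all e (run t) i
     then ops (output e (run t) i) else 0) <= 2 * deg e i ^ 2.
  case: ifP => // _; rewrite ops_exprH leq_mul2l /= -mulnn.
  by rewrite -/(deg e i); case: (deg e i) => // d; rewrite leq_pmulr.
apply: leq_trans (leq_add sum_le out_le) _.
rewrite (mulnDl 5 2) leq_add2r -mulnn mulnCA leq_mul2l /= leq_mul2r.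
by rewrite nb_sent_le orbT.
Qed.

Lemma nb_ops_S0 t i : i \in S0 -> leaf e i -> nb_ops e C S0 t i = 0.
Proof.
move=> iS0 leaf_i; rewrite /nb_ops iS0 addn0 big1 // => s _.
by rewrite big1 // => j _; rewrite /message leaf_i iS0.
Qed.

Hypothesis tree_e : is_tree e.

(** A missing message is missing because one it depends on was missing one
    step before. Following these back gives a path, which is simple because
    it always stays on the far side of the edge it has just crossed. *)
Lemma unsent_path t i j : e i j -> ~~ isSome (run t i j) ->
  exists p, [/\ path (avoiding e j) i p, uniq (i :: p) & size p = t].
Proof.
elim: t i j => [|t IHt] i j e_ij; first by exists [::].
rewrite runS_isSome negb_or => /andP[not_sends unsent].
move: not_sends; rewrite sendsE e_ij unsent /= negb_forall_in.
case/exists_inP=> k; rewrite !inE => /andP[k_j e_ik] unsent_k.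
have e_ki : e k i by rewrite (tree_sym tree_e).
have [p [path_p uniq_p size_p]] := IHt k i e_ki unsent_k.
exists (k :: p); split; last by rewrite /= size_p.
  rewrite /= (path_avoiding_nbr tree_e e_ij e_ik k_j path_p) andbT /avoiding.
  by rewrite e_ik k_j (edge_neq tree_e).
by rewrite cons_uniq (avoiding_notin _ path_p) ?(edge_neq tree_e).
Qed.

Lemma run_diam t i j : diam e <= t -> e i j -> isSome (run t i j).
Proof.
move=> t_ge e_ij; apply: contraTT t_ge => /(unsent_path e_ij).
case=> p [path_p uniq_p <-].
rewrite -ltnNge; apply: (@simple_path_diam _ _ tree_e j (i :: p)).
  by rewrite /= (tree_sym tree_e) e_ij (avoiding_path path_p).
by rewrite cons_uniq (avoiding_notin _ path_p) ?(edge_neq tree_e).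
Qed.

End Run.

(** * Correctness of the messages *)

Section Harmonic.
Local Open Scope ring_scope.
Variables (R : realFieldType) (I : finType) (e : rel I) (C : I -> I -> R).
Variables (S0 : {set I}).
Hypotheses (tree_e : is_tree e) (cond_C : is_conductance e C).
Hypothesis S0_leaf : forall s, s \in S0 -> leaf e s.
Local Notation run := (run e C S0).

Definition harmonic (F : I -> R) v :=
  \sum_(k in nbrs e v) C v k * (F v - F k) = 0.

(** The homogeneous conditions on a potential, for the nodes of [A]. *)
Definition harmonic_on (A : {set I}) (F : I -> R) :=
  (forall v, v \in A -> v \in S0 -> F v = 0) /\
  (forall v, v \in A -> v \notin S0 -> harmonic F v).

Lemma conductance_gt0 i j : e i j -> 0 < C i j.
Proof. by case: cond_C => _ _ H /H. Qed.

(** Induction over the messages in the order in which they are sent: [P] may be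
    assumed of all the messages present in the state that sends a new one. *)
Lemma run_ind (P : I -> I -> R * R -> Prop) :
  (forall st i j, sends e st i j ->
     (forall k l m, st k l = Some m -> P k l m) ->
     P i j (eval (message e C S0 st i j).1, eval (message e C S0 st i j).2)) ->
  forall t i j m, run t i j = Some m -> P i j m.
Proof.
move=> P_sends; elim=> [//|t IHt] i j m; rewrite /run iterS {1}/step.
by case: ifP => [sends_ij [<-]|_]; [apply: P_sends | apply: IHt].
Qed.

Lemma received_msg (st : state R I) k i : isSome (st k i) ->
  st k i = Some (msgH st k i, msgW st k i).
Proof. by rewrite /msgH /msgW; case: (st k i) => [[]|]. Qed.

(** What a branch does to a function that is harmonic on it is to scale the
    value at the node it hangs from: [W^{i -> j}] is the factor at the first
    node of the branch and [H^{i -> j}] the sum over the branch relative to the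
    value there. The bounds on [W^{i -> j}] keep the denominator positive. *)
Definition message_correct i j (m : R * R) :=
  [/\ 0 <= m.2 <= 1
    & forall F, harmonic_on (branch e i j) F ->
      [/\ F i = m.2 * F j,
          \sum_(v in branch e i j) F v = m.1 * F i
        & F j = 0 -> forall v, v \in branch e i j -> F v = 0]].

(** By harmonicity the flow through the edge from [i] to [j] is the sum of the
    flows through the other edges at [i], each of which is proportional to
    [F i] by induction. A leaf of [S0] is a branch by itself, with [F i = 0]. *)
Lemma run_correct t i j m : run t i j = Some m -> message_correct i j m.
Proof.
move: t i j m; apply: run_ind => st i j.
rewrite sendsE => /and3P[e_ij _ /forall_inP received] IH.
have IHk k : k \in nbrs e i :\ j ->
  message_correct k i (msgH st k i, msgW st k i).
  by move=> /received/received_msg/IH.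
have sub_k k : k \in nbrs e i :\ j -> branch e k i \subset branch e i j.
  by rewrite !inE => /andP[k_j e_ik]; apply: branch_sub.
have harm_k F k : k \in nbrs e i :\ j -> harmonic_on (branch e i j) F ->
    harmonic_on (branch e k i) F.
  move=> /sub_k/subsetP sub_ki [F0 F_harm].
  by split=> v /sub_ki; [apply: F0 | apply: F_harm].
have vanish F : harmonic_on (branch e i j) F -> F i = 0 ->
    forall v, v \in branch e i j -> F v = 0.
  move=> F_harm Fi0 v v_i; have [->//|v_neq] := eqVneq v i.
  have : v \in branch e i j :\ i by rewrite in_setD1 v_neq.
  rewrite branch_decomp // => /bigcupP[k k_i v_k].
  by have [_ /(_ F (harm_k F k k_i F_harm))[_ _]] := IHk k k_i; apply.
have [iS0|iS0] := boolP (i \in S0).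
  rewrite /message S0_leaf // iS0 /=.
  split=> [|F F_harm]; first by rewrite lexx ler01.
  have Fi0 : F i = 0 by case: F_harm => F0 _; apply: F0; rewrite ?branch_self.
  rewrite Fi0 !mul0r; split=> // [|_]; last exact: vanish.
  by rewrite big1 // => v; apply: vanish.
have [-> ->] := eval_message C st e_ij iS0.
rewrite eval_exprH eval_exprW; set r := resistance C i j.
set q := \sum_(k in _) _ / _.
have q_ge0 : 0 <= q.
  apply: sumr_ge0 => k k_i; have [/andP[_ w_le1] _] := IHk k k_i.
  move: k_i; rewrite !inE => /andP[_ e_ik].
  by rewrite /resistance div1r invrK mulr_ge0 ?subr_ge0 // ltW ?conductance_gt0.
have r_gt0 : 0 < r by rewrite divr_gt0 ?conductance_gt0.
have d_ge1 : 1 <= 1 + r * q by rewrite lerDl mulr_ge0 // ltW.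
have d_gt0 : 0 < 1 + r * q by apply: lt_le_trans ltr01 d_ge1.
split=> [|F F_harm] /=; first by rewrite invr_ge0 ltW //= invf_le1.
have F_k k : k \in nbrs e i :\ j -> F k = msgW st k i * F i.
  by move=> k_i; have [_ /(_ F (harm_k F k k_i F_harm))[]] := IHk k k_i.
have F_i : F i = (1 + r * q)^-1 * F j.
  have [_ /(_ i (branch_self _ _ _) iS0)] := F_harm.
  rewrite /harmonic (big_setD1 j) ?inE //=.
  rewrite (eq_bigr (fun k => (1 - msgW st k i) / resistance C i k * F i)).
    (* [flow] is [C i j * (F i - F j) + q * F i = 0]; multiply by [r]. *)
    rewrite -mulr_suml -/q => flow.
    apply: (canRL (mulKf (lt0r_neq0 d_gt0))).
    have C_ij : C i j = r^-1 by rewrite /r /resistance div1r invrK.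
    move/(congr1 ( *%R r)): flow; rewrite C_ij mulrDr mulVKf ?lt0r_neq0 // mulr0.
    rewrite mulrA => /eqP; rewrite addrAC subr_eq0 => /eqP <-.
    by rewrite mulrDl mul1r.
  move=> k k_i; rewrite (F_k k) // /resistance div1r invrK.
  by rewrite [_ * C i k]mulrC -mulrA mulrBl mul1r.
split=> // [|Fj0]; last by apply: vanish => //; rewrite F_i Fj0 mulr0.
rewrite sum_branch // mulrDl mul1r addrC mulr_suml; congr (_ + _).
apply: eq_bigr => k k_i.
have [_ /(_ F (harm_k F k k_i F_harm))[_ -> _]] := IHk k k_i.
by rewrite (F_k k) //= mulrA [msgH _ _ _ * _]mulrC.
Qed.

(** * The output is the Harmonic Influence Centrality *)

Section Output.
Variables (t : nat) (l : I).
Hypotheses (lS0 : l \notin S0) (received : received_all e (run t) l).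

Lemma received_correct k : k \in nbrs e l ->
  message_correct k l (msgH (run t) k l, msgW (run t) k l).
Proof. by move=> /(forall_inP received)/received_msg/run_correct. Qed.

Lemma harmonic_branch F k : k \in nbrs e l ->
  harmonic_on [set~ l] F -> harmonic_on (branch e k l) F.
Proof.
move=> k_l [F0 F_harm]; have sub_kl : {subset branch e k l <= [set~ l]}.
  by move=> v v_k; rewrite (tree_decomp tree_e); apply/bigcupP; exists k.
by split=> v /sub_kl; [apply: F0 | apply: F_harm].
Qed.

Lemma harmonic_eq0 F : harmonic_on [set~ l] F -> F l = 0 -> F =1 fun=> 0.
Proof.
move=> F_harm Fl0 v; have [->//|v_l] := eqVneq v l.
have : v \in [set~ l] by rewrite in_setC1.
rewrite (tree_decomp tree_e) => /bigcupP[k k_l v_k].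
have [_ /(_ F (harmonic_branch k_l F_harm))[_ _]] := received_correct k_l.
exact.
Qed.

Lemma harmonic_sum F : harmonic_on [set~ l] F ->
  \sum_v F v = eval (output e (run t) l) * F l.
Proof.
move=> F_harm; rewrite eval_exprH (sum_tree tree_e F l) mulrDl mul1r addrC.
congr (_ + _); rewrite mulr_suml; apply: eq_bigr => k k_l.
have [_ /(_ F (harmonic_branch k_l F_harm))[/= F_k -> _]] := received_correct k_l.
by rewrite F_k mulrA [msgH _ _ _ * _]mulrC.
Qed.

(** A potential of [l] is a solution of [boundary_op W = D], where [D] is 1 at
    [l] and 0 elsewhere. *)
Definition boundary_op (F : {ffun I -> R^o}) : {ffun I -> R^o} :=
  [ffun v => if v \in l |: S0 then F v
             else \sum_(k in nbrs e v) C v k * (F v - F k)].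

Lemma boundary_opE F v :
  boundary_op F v = if v \in l |: S0 then F v
                    else \sum_(k in nbrs e v) C v k * (F v - F k).
Proof. by rewrite ffunE. Qed.

Lemma boundary_op_linear : linear boundary_op.
Proof.
move=> a F G; apply/ffunP=> v; rewrite !ffunE; case: ifP => // _.
rewrite scaler_sumr -big_split; apply: eq_bigr => k _ /=.
rewrite !ffunE /= /GRing.scale /=.
by rewrite mulrCA -mulrDr; congr (_ * _); rewrite mulrBr opprD addrACA.
Qed.

HB.instance Definition _ :=
  GRing.isLinear.Build R {ffun I -> R^o} {ffun I -> R^o} _ boundary_op
    boundary_op_linear.

(** An element of the kernel satisfies the homogeneous conditions outside [l]
    and vanishes at [l], hence is zero; so the operator is onto. *)
Lemma potential_exists : exists W, is_potential e C S0 l W.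
Proof.
have inj : lker (linfun boundary_op) == 0%VS.
  apply/lker0P=> F G; rewrite !lfunE /= => eq_FG.
  have op0 : boundary_op (F - G) = 0 by rewrite linearB /= eq_FG subrr.
  suff: (F - G) =1 fun=> 0.
    move=> FG0; apply/eqP; rewrite -subr_eq0; apply/eqP/ffunP=> v.
    by rewrite FG0 ffunE.
  have op0v v : boundary_op (F - G) v = 0 by rewrite op0 ffunE.
  apply: harmonic_eq0; last first.
    by have := op0v l; rewrite boundary_opE setU11.
  split=> v; rewrite in_setC1 => v_l vS0; have := op0v v.
    by rewrite boundary_opE in_setU1 vS0 orbT.
  by rewrite boundary_opE in_setU1 (negPf vS0) (negPf v_l).
pose D : {ffun I -> R^o} := [ffun v => (v == l)%:R].
have : D \in limg (linfun boundary_op) by rewrite lker0_limgf ?memvf.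
case/memv_imgP=> W _; rewrite lfunE /= => def_D; exists W.
have op_W v : boundary_op W v = (v == l)%:R by rewrite -def_D ffunE.
split=> [s sS0||i].
- have := op_W s; rewrite boundary_opE in_setU1 sS0 orbT => ->.
  by case: eqP sS0 lS0 => // -> ->.
- by have := op_W l; rewrite boundary_opE setU11 eqxx.
rewrite setUC => i_notin; have := op_W i; rewrite boundary_opE (negPf i_notin).
by move: i_notin; rewrite in_setU1 negb_or => /andP[/negPf->].
Qed.

Lemma potential_harmonic W : is_potential e C S0 l W -> harmonic_on [set~ l] W.
Proof.
case=> W0 _ W_harm; split=> v; rewrite in_setC1 => v_l vS0; first exact: W0.
by apply: W_harm; rewrite !inE negb_or vS0.
Qed.

Lemma output_HIC : is_HIC e C S0 l (eval (output e (run t) l)).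
Proof.
have [W W_pot] := potential_exists.
have W_harm := potential_harmonic W_pot.
have [_ Wl _] := W_pot.
exists W; split; last by rewrite (harmonic_sum W_harm) Wl mulr1.
split=> // V V_pot; have V_harm := potential_harmonic V_pot.
have [_ Vl _] := V_pot.
apply/ffunP=> v; apply/eqP; rewrite -subr_eq0; apply/eqP.
apply: (harmonic_eq0 (F := fun u => W u - V u)); last by rewrite Wl Vl subrr.
case: W_harm V_harm => W0 W_harm [V0 V_harm].
split=> u u_l uS0; first by rewrite W0 // V0 // subrr.
rewrite /harmonic (eq_bigr (fun k => C u k * (W u - W k) - C u k * (V u - V k))).
  by rewrite sumrB W_harm // V_harm // subrr.
by move=> k _; rewrite -mulrBr !opprD addrACA.
Qed.

End Output.
End Harmonic.

Theorem proposition5 :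
  exists K K' : nat,
  forall (R : realFieldType) (I : finType) (e : rel I) (C : I -> I -> R)
         (S0 : {set I}),
    is_tree e -> is_conductance e C -> (forall s, s \in S0 -> leaf e s) ->
    [/\ (forall (t : nat) (i : I), diam e <= t -> i \notin S0 ->
           received_all e (run e C S0 t) i) /\
        (forall (t : nat) (i : I), i \notin S0 ->
           received_all e (run e C S0 t) i ->
           is_HIC e C S0 i (eval (output e (run e C S0 t) i))),
        forall (t : nat) (i : I), diam e <= t -> nb_sent e C S0 t i = deg e i,
        forall t : nat, \sum_(i : I) nb_sent e C S0 t i <= 2 * #|I|,
        forall (t : nat) (i : I), nb_ops e C S0 t i <= K * deg e i ^ 2
      & forall t : nat, \sum_(i : I) nb_ops e C S0 t i
                          <= K' * \sum_(i | i \notin S0) deg e i ^ 2].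
Proof.
exists 7, 7 => R I e C S0 tree_e cond_C S0_leaf; split.
- split=> t i; last exact: output_HIC.
  move=> t_ge _; apply/forall_inP=> k; rewrite inE => e_ik.
  by apply: run_diam => //; rewrite (tree_sym tree_e).
- move=> t i t_ge; rewrite nb_sentE; apply: eq_card => j; rewrite !inE.
  by apply/idP/idP; [apply: run_edge | apply: run_diam].
- move=> t; apply: leq_trans (sum_deg_le tree_e).
  by apply: leq_sum => i _; apply: nb_sent_le.
- by move=> t i; apply: nb_ops_le.
move=> t; rewrite (bigID (mem S0)) /= big1 ?add0n => [|i iS0].
  by rewrite big_distrr; apply: leq_sum => i _; apply: nb_ops_le.
by rewrite nb_ops_S0 ?S0_leaf.
Qed.
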